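(* Let $k\ge2$ and $\alpha\in(0,1]$. The moving average cross-over strategy $\mathrm{MA}[k]$ is universalizable both when the long/short allocation function is the line $g_\ell(x)=\frac{x+1}{2}$ and when, on each day $t\ge1$, it is the linear step approximation $g_{(t)}$ (with $g_{(1)}$ used on day $0$), where $g_{(t)}(x)=0$ for $x<-\frac1t$, $g_{(t)}(x)=\frac t2(x+\frac1t)$ for $-\frac1t\le x\le\frac1t$, and $g_{(t)}(x)=1$ for $x>\frac1t$.
   Context: Single-stock trading setting: $m=2$ assets, a long and a short position in one stock, with margin requirement $\alpha\in(0,1]$. On day $t$ the stock price changes by a factor $y_t\in(0,1+\alpha)$, and the return vector is $\mathbf x_t=(y_t,\,1+\frac{1-y_t}{\alpha})\in(0,\infty)^2$. On day $t$ a price-history vector $\mathbf v_t=(v_{t1},\dots,v_{tk})\in(0,1]^k$ is given ($v_{tj}$ the normalized price on day $t-j$). $\mathrm{MA}[k]$ has parameter space $\mathcal W_k^2$, where $\mathcal W_k=\{\mathbf w\in[0,1]^k:\sum_i w_i=1\}$, parameters $(\mathbf w_F,\mathbf w_S)$, and investment description $\mathrm{MA}_t(\mathbf w_F,\mathbf w_S)=\big(g((\mathbf w_F-\mathbf w_S)\cdot\mathbf v_t),\,1-g((\mathbf w_F-\mathbf w_S)\cdot\mathbf v_t)\big)$ for a long/short allocation function $g:[-1,1]\to[0,1]$. General notions: for an investment strategy $S$ with parameter space $\mathbb W=\mathcal W_k^\ell$ and descriptions $S_t(\mathbf w)\in\mathcal W_m$, $\mathcal R_n(S(\mathbf w))=\prod_{t=0}^{n-1}S_t(\mathbf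 w)\cdot\mathbf x_t$ ($\mathcal R_0\equiv1$), $\mathcal L_n=\frac1n\log\mathcal R_n$; for parameter-free $U$, $\mathcal R_n(U)=\prod_{t<n}U_t\cdot\mathbf x_t$, $\mathcal L_n(U)=\frac1n\log\mathcal R_n(U)$. $\mu$ is the uniform probability measure on $\mathbb W$ and $\mathcal U(S)$ is the strategy with $\mathcal U_t(S)=\int_{\mathbb W}S_t\mathcal R_t\,d\mu/\int_{\mathbb W}\mathcal R_t\,d\mu$. $U$ is a universalization of $S$ if there is $\eta_n\to0$, independent of market data, with $\mathcal L_n(U)\ge\sup_{\mathbf w}\mathcal L_n(S(\mathbf w))-\eta_n$ for all $n$ and all market data. For $\varepsilon\in(0,1)$ the $\varepsilon$-modification is $\bar S_t(\mathbf w)=(1-\frac{\varepsilon}{2(t+1)^2})S_t(\mathbf w)+\frac{\varepsilon}{2m(t+1)^2}(1,\dots,1)$. $S$ is universalizable if for every $\varepsilon\in(0,1)$, $\mathcal U(\bar S)$ is a universalization of $S$. *)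

(* Defs.v *)
From HB Require Import structures.
From mathcomp Require Import all_boot all_order all_algebra.
From mathcomp Require Import all_classical all_reals all_analysis.
Set Implicit Arguments. Unset Strict Implicit. Unset Printing Implicit Defensive.
Import Order.TTheory GRing.Theory Num.Theory.
Import numFieldNormedType.Exports.
Local Open Scope classical_set_scope.
Local Open Scope ring_scope.

Section Defs.
Variables (R : realType) (k : nat) (alpha : R).

(* y t : price change factor on day t ; v t : price-history vector on day t *)
Definition market_ok (y : nat -> R) (v : nat -> 'I_k -> R) : Prop :=
  (forall t, 0 < y t < 1 + alpha) /\ (forall t (j : 'I_k), 0 < v t j <= 1).

Definition xret (y : nat -> R) (t : nat) : R * R :=
  (y t, 1 + (1 - y t) / alpha).

Definition dot2 (a b : R * R) : R := a.1 * b.1 + a.2 * b.2.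

Definition inW (w : 'I_k -> R) : Prop :=
  (forall i, 0 <= w i <= 1) /\ \sum_(i < k) w i = 1.

Definition vec_of (s : seq R) : 'I_k -> R :=
  fun i => if (nat_of_ord i < k.-1)%N then nth 0 s i else 1 - \sum_(x <- s) x.

(* Lebesgue integral over the projected simplex
   { (s_0,..,s_{n-1}) : s_i >= 0, s_0 + ... + s_{n-1} <= r }, as iterated
   one-dimensional Lebesgue integrals. *)
Fixpoint simp_int (n : nat) (r : R) (h : seq R -> R) : R :=
  match n with
  | O => h [::]
  | n'.+1 => \int[@lebesgue_measure R]_(x in `[0, r]) simp_int n' (r - x) (fun s => h (x :: s))
  end.

(* (unnormalized) Lebesgue integral over W = W_k^2, via the affine
   parametrization of each simplex by its first k-1 coordinates *)
Definition intW (F : ('I_k -> R) -> ('I_k -> R) -> R) : R :=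
  simp_int k.-1 1 (fun s1 => simp_int k.-1 1 (fun s2 => F (vec_of s1) (vec_of s2))).

(* integral w.r.t. the uniform probability measure mu on W *)
Definition muint (F : ('I_k -> R) -> ('I_k -> R) -> R) : R :=
  intW F / intW (fun _ _ => 1).

Definition strategy := nat -> ('I_k -> R) -> ('I_k -> R) -> R * R.
Definition pfstrategy := nat -> R * R.

Definition Ret (S : strategy) (y : nat -> R) (n : nat) (a b : 'I_k -> R) : R :=
  \prod_(t < n) dot2 (S t a b) (xret y t).

Definition Lret (S : strategy) (y : nat -> R) (n : nat) (a b : 'I_k -> R) : R :=
  ln (Ret S y n a b) / n%:R.

Definition RetU (U : pfstrategy) (y : nat -> R) (n : nat) : R :=
  \prod_(t < n) dot2 (U t) (xret y t).

Definition LretU (U : pfstrategy) (y : nat -> R) (n : nat) : R :=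
  ln (RetU U y n) / n%:R.

Definition univ (S : strategy) (y : nat -> R) : pfstrategy :=
  fun t =>
    (muint (fun a b => (S t a b).1 * Ret S y t a b) / muint (Ret S y t),
     muint (fun a b => (S t a b).2 * Ret S y t a b) / muint (Ret S y t)).

Definition emod (eps : R) (S : strategy) : strategy :=
  fun t a b =>
    let c := eps / (2 * (t.+1%:R) ^+ 2) in
    ((1 - c) * (S t a b).1 + eps / (4 * (t.+1%:R) ^+ 2),
     (1 - c) * (S t a b).2 + eps / (4 * (t.+1%:R) ^+ 2)).

Definition is_universalization (U : (nat -> R) -> (nat -> 'I_k -> R) -> pfstrategy)
    (S : (nat -> 'I_k -> R) -> strategy) : Prop :=
  exists eta : nat -> R, eta @ \oo --> 0 /\
    forall (n : nat), (0 < n)%N ->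
    forall y v, market_ok y v ->
    forall wF wS, inW wF -> inW wS ->
      Lret (S v) y n wF wS - eta n <= LretU (U y v) y n.

Definition universalizable (S : (nat -> 'I_k -> R) -> strategy) : Prop :=
  forall eps : R, 0 < eps < 1 ->
    is_universalization (fun y v => univ (emod eps (S v)) y) S.

Definition MA (g : nat -> R -> R) (v : nat -> 'I_k -> R) : strategy :=
  fun t wF wS =>
    let a := g t (\sum_(i < k) (wF i - wS i) * v t i) in (a, 1 - a).

End Defs.

Definition g_line (R : realType) (x : R) : R := (x + 1) / 2.

Definition g_step (R : realType) (t : nat) (x : R) : R :=
  if x < - (t%:R)^-1 then 0
  else if x <= (t%:R)^-1 then t%:R / 2 * (x + (t%:R)^-1)
  else 1.

Definition g_day (R : realType) (t : nat) (x : R) : R := @g_step R (maxn t 1) x.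

(* Main.v *)
Require Import Defs.
From HB Require Import structures.
From mathcomp Require Import all_boot all_order all_algebra.
From mathcomp Require Import all_classical all_reals all_analysis.
From mathcomp Require Import ring lra.
Set Implicit Arguments. Unset Strict Implicit. Unset Printing Implicit Defensive.
Import Order.TTheory GRing.Theory Num.Theory.
Import numFieldNormedType.Exports.
Local Open Scope classical_set_scope.
Local Open Scope ring_scope.

(** The return of the universal portfolio telescopes to the average over [W] of the
    returns of the [eps]-modified strategy.  That average is bounded below by the
    contribution of a box of side [delta / k] inside the parameter space, all of whose
    points are within [O(delta)] of the competing parameter.  Every component of the
    modified strategy is at least [eps / (4 (t+1)^2)] and the allocation functions are
    [(t+1)/2]-Lipschitz, so for [delta] of order [n^-4] the day-[t] factor on the box is
    at least [(t+1)/(t+2)] times that of the modified competitor, itself at least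
    [(t+1)/(t+2)] times that of the competitor.  Both losses and the volume of the box
    are polynomial in [n], so the loss in the growth rate is [O(log n / n)]. *)

(** * Integrals of Lipschitz functions over a segment *)

Section Interval.
Variable R : realType.
Local Notation mu := (@lebesgue_measure R).
Implicit Types (a b C : R) (f g : R -> R).

(** Slices of simplex integrals come with explicit Lipschitz constants, so integrability is always
    obtained from a bound of this form. *)
Definition lip_itv a b C f :=
  forall x y, a <= x <= b -> a <= y <= b -> `|f x - f y| <= C * `|x - y|.

Lemma lip_itv_integrable a b C f :
  lip_itv a b C f -> mu.-integrable `[a, b] (EFin \o f).
Proof.
move=> lf; apply: continuous_compact_integrable; first exact: segment_compact.
apply/subspace_continuousP => x xab; apply/cvgrPdist_lt => e e0.
(* [C] may be zero or negative, so [|C| + 1] serves as a positive Lipschitz constant. *)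
have C0 : 0 < `|C| + 1 by rewrite ltr_wpDl.
near=> y.
have yab : [set` `[a, b]] y by near: y; apply: withinT.
move: xab yab; rewrite /= !in_itv /= => xab yab.
apply: le_lt_trans (lf _ _ xab yab) _.
have xy : `|x - y| < e / (`|C| + 1).
  near: y; rewrite near_withinE.
  have : \forall y \near x, `|x - y| < e / (`|C| + 1).
    by apply: (@nbhsx_ballx _ R^o x _ (divr_gt0 e0 C0)).
  by apply: filterS.
rewrite ltr_pdivlMr // in xy; apply: le_lt_trans xy.
rewrite mulrC ler_wpM2l //; have := ler_norm C; lra.
Unshelve. all: by end_near. Qed.

Lemma Rintegral_itv_cst a b (c : R) : a <= b ->
  \int[mu]_(x in `[a, b]) c = c * (b - a).
Proof.
move=> ab; rewrite Rintegral_cst//= lebesgue_measure_itv/= lte_fin.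
case: ltP => // ba; have -> : b = a by apply/le_anti; rewrite ba ab.
by rewrite subrr.
Qed.

Lemma le_Rintegral_itv a b C C' f g : lip_itv a b C f -> lip_itv a b C' g ->
  (forall x, a <= x <= b -> f x <= g x) ->
  \int[mu]_(x in `[a, b]) f x <= \int[mu]_(x in `[a, b]) g x.
Proof.
move=> /lip_itv_integrable fi /lip_itv_integrable gi fg.
by apply: le_Rintegral => // x /=; rewrite in_itv/=; exact: fg.
Qed.

Lemma normr_Rintegral_itv a b C f (M : R) : a <= b -> lip_itv a b C f ->
  (forall x, a <= x <= b -> `|f x| <= M) ->
  `|\int[mu]_(x in `[a, b]) f x| <= M * (b - a).
Proof.
move=> ab lf fM; rewrite -Rintegral_itv_cst //.
have fi := lip_itv_integrable lf; apply: le_trans (le_normr_Rintegral _ fi) _ => //.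
apply: (@le_Rintegral_itv _ _ C 0) => //.
- by move=> x y xab yab; apply: le_trans (ler_dist_dist _ _) (lf _ _ _ _).
- by move=> x y _ _; rewrite subrr normr0 mul0r.
Qed.

Lemma sub_lip_itv a b a' b' C f : a <= a' -> b' <= b ->
  lip_itv a b C f -> lip_itv a' b' C f.
Proof.
by move=> aa' bb' lf x y /andP[? ?] /andP[? ?]; apply: lf; apply/andP; split; lra.
Qed.

Lemma lip_itvB a b C C' f g : lip_itv a b C f -> lip_itv a b C' g ->
  lip_itv a b (C + C') (fun x => f x - g x).
Proof.
move=> lf lg x y xab yab.
have -> : f x - g x - (f y - g y) = (f x - f y) - (g x - g y) by ring.
by apply: le_trans (ler_normB _ _) _; rewrite mulrDl lerD ?lf ?lg.
Qed.

Lemma Rintegral_itv_split a b c C f : a <= b <= c -> lip_itv a c C f ->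
  \int[mu]_(x in `[a, c]) f x =
  \int[mu]_(x in `[a, b]) f x + \int[mu]_(x in `[b, c]) f x.
Proof.
move=> /andP[ab bc] lf; have fi := lip_itv_integrable lf.
have /= := @Rintegral_itvB _ f (BLeft a) (BRight c) b fi.
rewrite !bnd_simp => /(_ ab bc) /eqP; rewrite subr_eq addrC => /eqP ->.
(* The difference formula yields the piece without its left endpoint [b]; adding that point does not
   change the integral. *)
congr (_ + _); apply: Rintegral_itv_obnd_cbnd.
apply: integrableS fi => //; apply: subset_itvr; by rewrite bnd_simp.
Qed.

Lemma Rintegral_itv_ge0 a b f : (forall x, a <= x <= b -> 0 <= f x) ->
  0 <= \int[mu]_(x in `[a, b]) f x.
Proof. by move=> f0; apply: Rintegral_ge0 => x /=; rewrite in_itv/=; exact: f0. Qed.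

Lemma Rintegral_itv_ge_sub a b a' b' C f (m : R) : a <= a' -> a' <= b' -> b' <= b ->
  lip_itv a b C f -> (forall x, a <= x <= b -> 0 <= f x) ->
  (forall x, a' <= x <= b' -> m <= f x) ->
  m * (b' - a') <= \int[mu]_(x in `[a, b]) f x.
Proof.
move=> aa' ab' bb' lf f0 fm.
rewrite (@Rintegral_itv_split a a' b C) //; last by apply/andP; split; lra.
rewrite (@Rintegral_itv_split a' b' b C) //; last first.
- exact: sub_lip_itv lf.
- by apply/andP; split.
apply: (@le_trans _ _ (\int[mu]_(x in `[a', b']) f x)).
  rewrite -Rintegral_itv_cst //; apply: (@le_Rintegral_itv _ _ 0 C) => //.
  + by move=> x y _ _; rewrite subrr normr0 mul0r.
  + exact: sub_lip_itv lf.
have : 0 <= \int[mu]_(x in `[a, a']) f x.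
  by apply: Rintegral_itv_ge0 => x /andP[? ?]; apply: f0; apply/andP; split; lra.
have : 0 <= \int[mu]_(x in `[b', b]) f x.
  by apply: Rintegral_itv_ge0 => x /andP[? ?]; apply: f0; apply/andP; split; lra.
lra.
Qed.

End Interval.

(** * Iterated integrals over the projected simplex *)

Section Simplex.
Variable R : realType.
Implicit Types (r C : R) (n : nat) (s : seq R) (h : seq R -> R).

Definition in_simplex n r s :=
  [/\ size s = n, forall i, 0 <= s`_i & \sum_(x <- s) x <= r].

Lemma in_simplex_cons n r x s : 0 <= x ->
  in_simplex n (r - x) s -> in_simplex n.+1 r (x :: s).
Proof.
move=> x0 [sz s0 sr]; split; first by rewrite /= sz.
- by case.
- by rewrite big_cons; lra.
Qed.

Lemma le_in_simplex n r r' s : r <= r' -> in_simplex n r s -> in_simplex n r' s.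
Proof. by move=> rr' [sz s0 sr]; split => //; exact: le_trans rr'. Qed.

Definition l1dist n s s' : R := \sum_(i < n) `|s`_i - s'`_i|.

(** One constant controls both values and l1-Lipschitz ratio: changing the radius of the simplex
    costs a value bound, changing the slice costs a Lipschitz bound. *)
Definition bounded_lip n r C h :=
  [/\ 0 <= C, forall s, in_simplex n r s -> `|h s| <= C &
   forall s s', in_simplex n r s -> in_simplex n r s' ->
     `|h s - h s'| <= C * l1dist n s s'].

Lemma le_bounded_lip n r r' C h : r' <= r ->
  bounded_lip n r C h -> bounded_lip n r' C h.
Proof.
move=> rr' [C0 hC hL]; split => // [s /(le_in_simplex rr')|]; first exact: hC.
by move=> s s' /(le_in_simplex rr') ? /(le_in_simplex rr'); exact: hL.
Qed.

Lemma bounded_lip_slice n r C h x : 0 <= x -> bounded_lip n.+1 r C h ->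
  bounded_lip n (r - x) C (fun s => h (x :: s)).
Proof.
move=> x0 [C0 hC hL]; split => // [s /(in_simplex_cons x0)|]; first exact: hC.
move=> s s' /(in_simplex_cons x0) xs /(in_simplex_cons x0) xs'.
by apply: le_trans (hL _ _ xs xs') _; rewrite /l1dist big_ord_recl/= subrr normr0 add0r.
Qed.

Lemma slice_dist n r C h x y s : 0 <= x -> 0 <= y -> bounded_lip n.+1 r C h ->
  in_simplex n (r - x) s -> in_simplex n (r - y) s ->
  `|h (x :: s) - h (y :: s)| <= C * `|x - y|.
Proof.
move=> x0 y0 [C0 hC hL] /(in_simplex_cons x0) xs /(in_simplex_cons y0) ys.
apply: le_trans (hL _ _ xs ys) _; rewrite /l1dist big_ord_recl/=.
by rewrite big1 ?addr0 // => i _; rewrite subrr normr0.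
Qed.

(* The three bounds are proved together: the continuity of the slice integrals in
   [simp_int n.+1], hence their integrability, needs the last two at rank [n]. *)
Definition simp_int_regular n := forall r C h, 0 <= r <= 1 -> bounded_lip n r C h ->
  [/\ `|simp_int n r h| <= C,
   forall r', 0 <= r' <= r -> `|simp_int n r h - simp_int n r' h| <= n%:R * C * (r - r') &
   forall C' h' e, 0 <= e -> bounded_lip n r C' h' ->
     (forall s, in_simplex n r s -> `|h s - h' s| <= e) ->
     `|simp_int n r h - simp_int n r h'| <= e].

(** Moving the slice changes both the integrand and the radius. For [y <= x] the integrands are
    compared on the smaller simplex of radius [r - x], at cost [C * |x - y|]; enlarging the radius
    to [r - y] then costs [n * C * |x - y|]. *)
Lemma lip_slice_of_regular n r C h : simp_int_regular n ->
  0 <= r <= 1 -> bounded_lip n.+1 r C h ->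
  lip_itv 0 r (n.+1%:R * C) (fun x => simp_int n (r - x) (fun s => h (x :: s))).
Proof.
move=> reg r01 bh x y.
wlog yx : x y / y <= x.
  move=> W x0 y0; have [yx|/ltW xy] := leP y x; first exact: W.
  by rewrite distrC (distrC x) W.
move=> /andP[x0 xr] /andP[y0 yr]; case/andP: r01 => r0 r1.
have ry01 : 0 <= r - y <= 1 by apply/andP; split; lra.
have rx01 : 0 <= r - x <= 1 by apply/andP; split; lra.
have rxy : 0 <= r - x <= r - y by apply/andP; split; lra.
have bx := bounded_lip_slice x0 bh; have b_y := bounded_lip_slice y0 bh.
have [_ /(_ _ rxy) L1 _] := reg _ _ _ ry01 b_y.
have rxy' : r - x <= r - y by lra.
have [C0 _ _] := bh.
have e0 : 0 <= C * `|x - y| by rewrite mulr_ge0.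
have [_ _ /(_ _ _ _ e0 (le_bounded_lip rxy' b_y)) L2] := reg _ _ _ rx01 bx.
have {}L2 := L2 (fun s sx => slice_dist x0 y0 bh sx (le_in_simplex rxy' sx)).
have -> : n.+1%:R * C * `|x - y| = C * `|x - y| + n%:R * C * (r - y - (r - x)).
  by rewrite (_ : r - y - (r - x) = `|x - y|) ?ger0_norm ?subr_ge0// -?natr1; ring.
rewrite distrC in L1.
apply: le_trans (lerD L2 L1); apply: le_trans (ler_normD _ _).
rewrite le_eqVlt; apply/orP; left; apply/eqP; congr (`| _ |); ring.
Qed.

(** Induction on the dimension. As [r <= 1], each integration runs over a segment of length at most
    [1] and preserves uniform bounds; the radius bound gains one term [C * (r - r')] per
    dimension. *)
Lemma simp_intP n : simp_int_regular n.
Proof.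
elim: n => [|n reg] r C h r01 bh.
  have s0 : in_simplex 0 r [::].
    by split => //; [case|rewrite big_nil; case/andP: r01].
  have [C0 hC hL] := bh; split => [|r' _|C' h' e _ _] /=; first exact: hC.
  + by rewrite subrr normr0 !mul0r.
  + exact.
have /andP[r0 r1] := r01; have [C0 hC hL] := bh.
have slice01 r' x : 0 <= r' <= r -> 0 <= x <= r' -> 0 <= r' - x <= 1.
  by move=> /andP[? ?] /andP[? ?]; apply/andP; split; lra.
have lh := lip_slice_of_regular reg r01 bh.
have boundh r' x : 0 <= r' <= r -> 0 <= x <= r' ->
    `|simp_int n (r' - x) (fun s => h (x :: s))| <= C.
  move=> r'r xr'; have [x0 _] := andP xr'; have [_ rr'] := andP r'r.
  have := bounded_lip_slice x0 (le_bounded_lip rr' bh).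
  by case/(reg _ _ _ (slice01 _ _ r'r xr')).
have rr : 0 <= r <= r by rewrite r0 lexx.
split => /=.
- apply: le_trans (normr_Rintegral_itv r0 lh (fun x => boundh r x rr)) _.
  by rewrite subr0 ler_piMr.
- move=> r' r'r; have /andP[r'0 r'r'] := r'r.
  have r'01 : 0 <= r' <= 1 by rewrite r'0 (le_trans r'r').
  have bh' := le_bounded_lip r'r' bh.
  have lh' := lip_slice_of_regular reg r'01 bh'.
  (* On [[0, r']] the slices differ only in radius, by [r - r'], which the rank [n] bound controls;
     the strip [[r', r]] contributes at most [C * (r - r')]. *)
  rewrite (Rintegral_itv_split r'r lh).
  have lhr' := sub_lip_itv (lexx 0) r'r' lh.
  rewrite addrAC -RintegralB //; [|exact: lip_itv_integrable lhr'|exact: lip_itv_integrable lh'].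
  apply: le_trans (ler_normD _ _) _.
  have -> : n.+1%:R * C * (r - r') = n%:R * C * (r - r') + C * (r - r').
    by rewrite -natr1; ring.
  apply: lerD; last first.
    apply: (normr_Rintegral_itv r'r' (sub_lip_itv r'0 (lexx r) lh)) => x /andP[r'x xr].
    by apply: boundh => //; apply/andP; split; lra.
  apply: (@le_trans _ _ (n%:R * C * (r - r') * (r' - 0))).
    apply: (normr_Rintegral_itv r'0 (lip_itvB lhr' lh')) => x xr'.
    have /andP[x0 xr] := xr'.
    have x0r : 0 <= x <= r by apply/andP; split; lra.
    have [_ + _] := reg _ _ _ (slice01 _ _ rr x0r) (bounded_lip_slice x0 bh).
    move=> /(_ (r' - x)); rewrite (_ : r - x - (r' - x) = r - r'); last ring.
    by apply; apply/andP; split; lra.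
  rewrite subr0 ler_piMr //; last by lra.
  by rewrite !mulr_ge0 // subr_ge0.
- move=> C' h' e e0 bh' hh'.
  have lh' := lip_slice_of_regular reg r01 bh'.
  rewrite -RintegralB //; [|exact: lip_itv_integrable lh|exact: lip_itv_integrable lh'].
  apply: (@le_trans _ _ (e * (r - 0))); last by rewrite subr0 ler_piMr.
  apply: (normr_Rintegral_itv r0 (lip_itvB lh lh')) => x xr; have /andP[x0 _] := xr.
  have [_ _] := reg _ _ _ (slice01 _ _ rr xr) (bounded_lip_slice x0 bh).
  move=> /(_ _ _ _ e0 (bounded_lip_slice x0 bh')); apply => s /(in_simplex_cons x0).
  exact: hh'.
Qed.

Lemma lip_slice n r C h : 0 <= r <= 1 -> bounded_lip n.+1 r C h ->
  lip_itv 0 r (n.+1%:R * C) (fun x => simp_int n (r - x) (fun s => h (x :: s))).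
Proof. exact: lip_slice_of_regular (@simp_intP n). Qed.

Lemma slice_itv r x : 0 <= r <= 1 -> 0 <= x <= r -> 0 <= r - x <= 1.
Proof. by move=> /andP[? ?] /andP[? ?]; apply/andP; split; lra. Qed.

Lemma simp_int_lin n r C C' h h' (a b : R) : 0 <= r <= 1 ->
  bounded_lip n r C h -> bounded_lip n r C' h' ->
  simp_int n r (fun s => a * h s + b * h' s) = a * simp_int n r h + b * simp_int n r h'.
Proof.
elim: n r C C' h h' => [//|n IH] r C C' h h' r01 bh bh' /=.
have lh := lip_slice r01 bh; have lh' := lip_slice r01 bh'.
rewrite -!RintegralZl //; [|exact: lip_itv_integrable lh'|exact: lip_itv_integrable lh].
rewrite -RintegralD //.
- apply: eq_Rintegral => x; rewrite inE/= in_itv/= => xr; have /andP[x0 _] := xr.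
  by apply: IH (slice_itv r01 xr) (bounded_lip_slice x0 bh) (bounded_lip_slice x0 bh').
- exact: integrableZl (lip_itv_integrable lh).
- exact: integrableZl (lip_itv_integrable lh').
Qed.

Lemma simp_int_ge0 n r h : (forall s, in_simplex n r s -> 0 <= h s) -> 0 <= r ->
  0 <= simp_int n r h.
Proof.
elim: n r h => [|n IH] r h h0 r0 /=.
  by apply: h0; split => //; [case|rewrite big_nil].
apply: Rintegral_itv_ge0 => x /andP[x0 xr]; apply: IH; last by lra.
by move=> s /(in_simplex_cons x0); exact: h0.
Qed.

(** The corner leaves room [n * d] in the simplex, so the box of side [d] fits inside. Each
    coordinate contributes a segment of length [d], and nonnegativity of [h] discards the rest. *)
Lemma simp_int_box n r C h (q : seq R) (d c : R) : 0 <= r <= 1 -> bounded_lip n r C h ->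
  0 <= d -> in_simplex n (r - n%:R * d) q ->
  (forall s, in_simplex n r s -> 0 <= h s) ->
  (forall s, in_simplex n r s -> (forall i, (i < n)%N -> q`_i <= s`_i <= q`_i + d) -> c <= h s) ->
  c * d ^+ n <= simp_int n r h.
Proof.
move=> + + d0; elim: n r C h q => [|n IH] r C h q r01 bh [sq q0 qr] h0 hc /=.
  rewrite expr0 mulr1; apply: hc => //.
  by split => //; [case|rewrite big_nil; case/andP: r01].
case: q sq q0 qr hc => // p q [sq] q0 qr hc.
have p0 : 0 <= p := q0 0%N.
have q0' i : 0 <= q`_i := q0 i.+1.
rewrite big_cons -natr1 in qr.
have sq0 : 0 <= \sum_(x <- q) x.
  by rewrite (big_nth 0) sumr_ge0.
have nd0 : 0 <= n%:R * d by rewrite mulr_ge0.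
rewrite exprSr mulrA (_ : _ * d = c * d ^+ n * (p + d - p)); last ring.
apply: (Rintegral_itv_ge_sub _ _ _ (lip_slice r01 bh)) => //; [lra|lra| |].
- move=> x /andP[x0 xr]; apply: simp_int_ge0; last by lra.
  by move=> s /(in_simplex_cons x0); exact: h0.
- move=> x /andP[px xpd]; have x0 : 0 <= x by lra.
  have xr : 0 <= x <= r by apply/andP; split; lra.
  apply: IH (slice_itv r01 xr) (bounded_lip_slice x0 bh) _ _ _.
  + by split => [|i|]; [exact: sq|exact: q0'|lra].
  + by move=> s /(in_simplex_cons x0); exact: h0.
  + move=> s ss qs; apply: hc; first exact: in_simplex_cons.
    by case=> [|i] /=; [rewrite px xpd|exact: qs].
Qed.

End Simplex.

Lemma eq_simp_int (R : realType) n (r : R) h h' : 0 <= r ->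
  (forall s, in_simplex n r s -> h s = h' s) -> simp_int n r h = simp_int n r h'.
Proof.
elim: n r h h' => [|n IH] r h h' r0 hh' /=.
  by apply: hh'; split => //; [case|rewrite big_nil].
apply: eq_Rintegral => x; rewrite inE/= in_itv/= => /andP[x0 xr].
apply: IH => [|s /(in_simplex_cons x0)]; [lra|exact: hh'].
Qed.

Lemma bounded_lip_cst (R : realType) n (r c : R) : bounded_lip n r `|c| (fun=> c).
Proof.
split => // s s' _ _; rewrite subrr normr0 mulr_ge0 //.
by apply: sumr_ge0.
Qed.

(** * Integration over pairs of weight vectors *)

Section ParameterSpace.
Variables (R : realType) (k' : nat).
Local Notation k := k'.+1.
Implicit Types (a b w wF wS : 'I_k -> R) (F G : ('I_k -> R) -> ('I_k -> R) -> R).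
Local Notation vec := (@vec_of R k).

Definition wdist a b : R := \sum_(i < k) `|a i - b i|.

Lemma wdist_ge0 a b : 0 <= wdist a b.
Proof. exact: sumr_ge0. Qed.

Lemma sum_in_simplex r (s : seq R) : in_simplex k' r s ->
  \sum_(x <- s) x = \sum_(i < k') s`_i.
Proof. by case=> sz _ _; rewrite (big_nth 0) big_mkord sz. Qed.

Lemma vec_lift s (i : 'I_k') : vec s (widen_ord (leqnSn k') i) = s`_i.
Proof. by rewrite /vec_of /= ltn_ord. Qed.

Lemma vec_max s : vec s ord_max = 1 - \sum_(x <- s) x.
Proof. by rewrite /vec_of /= ltnn. Qed.

Lemma inW_le1 w : (forall i, 0 <= w i) -> \sum_(i < k) w i = 1 -> inW w.
Proof.
move=> w0 sw; split => // i; rewrite w0 /= -sw (bigD1 i) //= lerDl.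
exact: sumr_ge0.
Qed.

Lemma inW_vec s : in_simplex k' 1 s -> inW (vec s).
Proof.
move=> ss; have [sz s0 s1] := ss; apply: inW_le1.
  by move=> i; rewrite /vec_of; case: ifP => _; rewrite ?s0 ?subr_ge0.
rewrite big_ord_recr /= vec_max (sum_in_simplex ss).
under eq_bigr do rewrite vec_lift.
by rewrite subrKC.
Qed.

(* The last coordinate is determined by the others, hence the factor 2. *)
Lemma wdist_vec_le r s w : in_simplex k' r s -> \sum_(i < k) w i = 1 ->
  wdist (vec s) w <= 2 * \sum_(i < k') `|s`_i - w (widen_ord (leqnSn k') i)|.
Proof.
move=> ss; rewrite /wdist !big_ord_recr /= => /eqP; rewrite eq_sym addrC -subr_eq => /eqP <-.
under eq_bigr do rewrite vec_lift.
rewrite vec_max (sum_in_simplex ss) mulr_natl mulr2n lerD2l.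
rewrite opprB addrC addrA subrK -sumrB.
by apply: le_trans (ler_norm_sum _ _ _) _; apply: ler_sum => i _; rewrite distrC.
Qed.

Lemma wdist_vec s s' : in_simplex k' 1 s -> in_simplex k' 1 s' ->
  wdist (vec s) (vec s') <= 2 * l1dist k' s s'.
Proof.
move=> ss ss'; apply: le_trans (wdist_vec_le ss (proj2 (inW_vec ss'))) _.
by rewrite /l1dist; under eq_bigr do rewrite vec_lift.
Qed.

Definition lipW C F := [/\ 0 <= C, forall a b, inW a -> inW b -> `|F a b| <= C &
  forall a b a' b', inW a -> inW b -> inW a' -> inW b' ->
    `|F a b - F a' b'| <= C * (wdist a a' + wdist b b')].

Lemma wdist_refl a : wdist a a = 0.
Proof. by rewrite /wdist big1 // => i _; rewrite subrr normr0. Qed.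

Lemma lipW_inner C F s : in_simplex k' 1 s -> lipW C F ->
  bounded_lip k' 1 (2 * C) (fun s2 => F (vec s) (vec s2)).
Proof.
move=> /inW_vec sW [C0 FC FL]; split; first by rewrite mulr_ge0.
- by move=> s2 /inW_vec s2W; apply: le_trans (FC _ _ sW s2W) _; lra.
- move=> s2 s2' ss2 ss2'; have := wdist_vec ss2 ss2'.
  move/inW_vec: ss2 => ss2; move/inW_vec: ss2' => ss2' D.
  apply: le_trans (FL _ _ _ _ sW ss2 sW ss2') _.
  by rewrite wdist_refl add0r (mulrC 2) -mulrA ler_wpM2l.
Qed.

Lemma itv01 : 0 <= (1 : R) <= 1. Proof. by rewrite ler01 lexx. Qed.

(** Uniformly close inner integrands have close integrals, by the third bound of [simp_intP], so the
    inner integral is itself an admissible integrand for the outer simplex. *)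
Lemma lipW_outer C F : lipW C F ->
  bounded_lip k' 1 (2 * C) (fun s => simp_int k' 1 (fun s2 => F (vec s) (vec s2))).
Proof.
move=> lF; have [C0 FC FL] := lF; split; first by rewrite mulr_ge0.
- by move=> s ss; case: (simp_intP itv01 (lipW_inner ss lF)).
- move=> s s' ss ss'; have [_ _] := simp_intP itv01 (lipW_inner ss lF).
  apply; last 2 first.
  + exact: lipW_inner ss' lF.
  + move=> s2 /inW_vec s2W; have := wdist_vec ss ss'.
    move/inW_vec: ss => ss; move/inW_vec: ss' => ss' D.
    apply: le_trans (FL _ _ _ _ ss s2W ss' s2W) _.
    by rewrite wdist_refl addr0 (mulrC 2) -mulrA ler_wpM2l.
  + by rewrite !mulr_ge0 //; exact: sumr_ge0.
Qed.

(** The class of integrands on the parameter space: it is closed under sums and products, hence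
    reaches the returns, and [intW] is linear on it. *)
Definition regW F := exists C, lipW C F.

Lemma regW_cst (c : R) : regW (fun _ _ => c).
Proof.
exists `|c|; split => // a b a' b' _ _ _ _.
by rewrite subrr normr0 mulr_ge0 // addr_ge0 ?wdist_ge0.
Qed.

Lemma regWD F G : regW F -> regW G -> regW (fun a b => F a b + G a b).
Proof.
move=> [C [C0 FC FL]] [C' [C'0 GC GL]]; exists (C + C'); split.
- exact: addr_ge0.
- by move=> a b aW bW; apply: le_trans (ler_normD _ _) _; rewrite lerD ?FC ?GC.
- move=> a b a' b' aW bW a'W b'W.
  rewrite opprD addrACA mulrDl; apply: le_trans (ler_normD _ _) _.
  by rewrite lerD ?FL ?GL.
Qed.

Lemma regWM F G : regW F -> regW G -> regW (fun a b => F a b * G a b).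
Proof.
(* [C * C'] bounds the product and [2 * (C * C')] its Lipschitz ratio; the sum serves for both. *)
move=> [C [C0 FC FL]] [C' [C'0 GC GL]]; exists (2 * (C * C') + C * C'); split.
- by rewrite addr_ge0 ?mulr_ge0.
- move=> a b aW bW; rewrite normrM.
  apply: le_trans (ler_pM _ _ (FC _ _ aW bW) (GC _ _ aW bW)) _ => //.
  by rewrite lerDr !mulr_ge0.
- move=> a b a' b' aW bW a'W b'W.
  have -> : F a b * G a b - F a' b' * G a' b' =
    F a b * (G a b - G a' b') + (F a b - F a' b') * G a' b' by ring.
  set D := wdist a a' + wdist b b'.
  have D0 : 0 <= D by rewrite addr_ge0 ?wdist_ge0.
  apply: le_trans (ler_normD _ _) _; rewrite !normrM.
  have h1 : `|F a b| * `|G a b - G a' b'| <= C * (C' * D).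
    by apply: ler_pM => //; [exact: FC|exact: GL].
  have h2 : `|F a b - F a' b'| * `|G a' b'| <= C * D * C'.
    by apply: ler_pM => //; [exact: FL|exact: GC].
  apply: le_trans (lerD h1 h2) _.
  have h3 : 0 <= C * C' * D by rewrite !mulr_ge0.
  lra.
Qed.

Lemma intW_lin F G (x y : R) : regW F -> regW G ->
  intW (fun a b => x * F a b + y * G a b) = x * intW F + y * intW G.
Proof.
move=> [C lF] [C' lG]; rewrite /intW -(simp_int_lin x y itv01 (lipW_outer lF) (lipW_outer lG)).
apply: eq_simp_int => // s ss.
by rewrite (simp_int_lin x y itv01 (lipW_inner ss lF) (lipW_inner ss lG)).
Qed.

Section Box.
Variables (w : 'I_k -> R) (delta : R).
Hypotheses (wW : inW w) (delta01 : 0 <= delta <= 1).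

(** Shrinking the free coordinates by [1 - delta] leaves room [delta] under the face of the simplex,
    so a box of side [delta / k] fits even when [w] lies on the boundary. *)
Definition box_corner : seq R :=
  mkseq (fun i => (1 - delta) * w (inord i)) k'.

Lemma nth_box_corner (i : 'I_k') :
  box_corner`_i = (1 - delta) * w (widen_ord (leqnSn k') i).
Proof.
rewrite nth_mkseq //; congr (_ * w _); apply: val_inj => /=.
by rewrite inordK // ltnS ltnW.
Qed.

Lemma box_side : k%:R * (delta / k%:R) = delta.
Proof. by rewrite mulrC divfK // pnatr_eq0. Qed.

Lemma box_corner_in : in_simplex k' (1 - k'%:R * (delta / k%:R)) box_corner.
Proof.
have [w0 w1] := wW; have /andP[d0 d1] := delta01; split; first by rewrite size_mkseq.
- move=> i; have [ik|ki] := ltnP i k'.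
    rewrite nth_mkseq // mulr_ge0 ?subr_ge0 //; by case/andP: (w0 (inord i)).
  by rewrite nth_default // size_mkseq.
- rewrite (big_nth 0) big_mkord size_mkseq.
  under eq_bigr do rewrite nth_box_corner.
  rewrite -mulr_sumr.
  have s1 : \sum_(i < k') w (widen_ord (leqnSn k') i) <= 1.
    rewrite -w1 big_ord_recr /= lerDl; by case/andP: (w0 ord_max).
  have h1 : (1 - delta) * \sum_(i < k') w (widen_ord (leqnSn k') i) <= (1 - delta) * 1.
    by rewrite ler_wpM2l // subr_ge0.
  have := box_side; rewrite -natr1 mulrDl mul1r.
  have : 0 <= delta / (k'%:R + 1) by rewrite divr_ge0.
  lra.
Qed.

(** Shrinking lowers a free coordinate by at most [delta] and the box raises it by at most
    [delta / k], so each moves by at most [delta]; the factor 2 accounts for the last coordinate. *)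
Lemma box_near s : in_simplex k' 1 s ->
  (forall i, (i < k')%N -> box_corner`_i <= s`_i <= box_corner`_i + delta / k%:R) ->
  wdist (vec s) w <= 2 * k%:R * delta.
Proof.
move=> ss sb; apply: le_trans (wdist_vec_le ss (proj2 wW)) _.
have [w0 _] := wW; have /andP[d0 d1] := delta01.
rewrite -mulrA ler_pM2l //.
apply: (@le_trans _ _ (\sum_(i < k') delta)); last first.
  rewrite sumr_const card_ord -[delta *+ _]mulr_natl ler_wpM2r // ler_nat; exact: leqnSn.
apply: ler_sum => i _; have := sb i (ltn_ord i); rewrite nth_box_corner.
move: (w _) (w0 (widen_ord (leqnSn k') i)) => p /andP[p0 p1] /andP[lo hi].
have dk : delta / k%:R <= delta by rewrite ler_pdivrMr // ler_peMr // ler1n.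
have dp : delta * p <= delta by rewrite ler_piMr.
have dp0 : 0 <= delta * p by rewrite mulr_ge0.
move: (delta / _) dk lo hi => e dk lo hi.
by rewrite ler_norml; apply/andP; split; lra.
Qed.

End Box.

(** The box estimate is used once per simplex, the inner use supplying the pointwise bound for the
    outer one. *)
Lemma intW_box F wF wS (delta c : R) : regW F -> inW wF -> inW wS -> 0 <= delta <= 1 ->
  (forall a b, inW a -> inW b -> 0 <= F a b) ->
  (forall a b, inW a -> inW b ->
     wdist a wF <= 2 * k%:R * delta -> wdist b wS <= 2 * k%:R * delta -> c <= F a b) ->
  c * (delta / k%:R) ^+ k' * (delta / k%:R) ^+ k' <= intW F.
Proof.
move=> [C lF] FW SW d01 F0 Fc.
have d0 : 0 <= delta / k%:R by rewrite divr_ge0 //; case/andP: d01.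
apply: (simp_int_box itv01 (lipW_outer lF) d0 (box_corner_in FW d01)).
- move=> s /inW_vec sW; apply: simp_int_ge0 => // s2 /inW_vec s2W; exact: F0.
- move=> s ss sb.
  apply: (simp_int_box itv01 (lipW_inner ss lF) d0 (box_corner_in SW d01)).
  + by move=> s2 /inW_vec s2W; apply: F0 => //; exact: inW_vec.
  + move=> s2 ss2 sb2; apply: Fc; [exact: inW_vec|exact: inW_vec| |].
    * exact: box_near sb.
    * exact: box_near sb2.
Qed.

(** Dividing by a volume of at most [1] can only increase a nonnegative integral, so lower bounds on
    [intW] pass to [muint]. *)
Lemma intW1_le1 : @intW R k (fun _ _ => 1) <= 1.
Proof.
rewrite /intW; have b1 := bounded_lip_cst k' 1 (1 : R).
have [c1 _ _] := simp_intP itv01 b1; set c := simp_int _ _ _ in c1.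
have [cc _ _] := simp_intP itv01 (bounded_lip_cst k' 1 c).
by apply: le_trans (ler_norm _) (le_trans cc _); rewrite normr1 in c1.
Qed.

(** The box estimate with [delta = 1], whose corner is the origin, applied to the constant [1]. *)
Lemma intW1_gt0 wF wS : inW wF -> inW wS -> 0 < @intW R k (fun _ _ => 1).
Proof.
move=> FW SW; have := @intW_box (fun _ _ => 1) wF wS 1 1 (regW_cst 1) FW SW itv01.
move=> /(_ (fun _ _ _ _ => ler01) (fun _ _ _ _ _ _ => lexx 1)); apply: lt_le_trans.
by rewrite !mulr_gt0 // exprn_gt0 // divr_gt0.
Qed.

End ParameterSpace.

(** * Returns of the modified strategy near a competitor *)

Lemma prod_succ_ratio (R : realType) n :
  \prod_(t < n) (t.+1%:R / t.+2%:R) = n.+1%:R^-1 :> R.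
Proof.
elim: n => [|n IH]; first by rewrite big_ord0 invr1.
by rewrite big_ord_recr /= IH mulrA mulVf ?pnatr_eq0 // mul1r.
Qed.

Section Allocation.
Variables (R : realType) (k' : nat) (alpha : R) (g : nat -> R -> R).
Local Notation k := k'.+1.
Implicit Types (a b wF wS : 'I_k -> R).
Hypothesis alpha0 : 0 < alpha.
Hypothesis g01 : forall t x, -1 <= x <= 1 -> 0 <= g t x <= 1.
Hypothesis g_lip : forall t x y, `|g t x - g t y| <= t.+1%:R / 2 * `|x - y|.
Variables (y : nat -> R) (v : nat -> 'I_k -> R).
Hypothesis mok : market_ok alpha y v.

Let signal t a b := \sum_(i < k) (a i - b i) * v t i.
Let alloc t a b := g t (signal t a b).

Lemma signal_itv t a b : inW a -> inW b -> -1 <= signal t a b <= 1.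
Proof.
move=> [a0 a1] [b0 b1]; have [_ v01] := mok.
have bnd w : inW w -> 0 <= \sum_(i < k) w i * v t i <= 1.
  move=> [w0 w1]; apply/andP; split.
    apply: sumr_ge0 => i _; have /andP[? _] := w0 i; have /andP[? _] := v01 t i.
    by rewrite mulr_ge0 // ltW.
  rewrite -w1; apply: ler_sum => i _; have /andP[? _] := w0 i; have /andP[? ?] := v01 t i.
  exact: ler_piMr.
have -> : signal t a b = \sum_(i < k) a i * v t i - \sum_(i < k) b i * v t i.
  by rewrite -sumrB; apply: eq_bigr => i _; rewrite mulrBl.
have /andP[] := bnd a (conj a0 a1); have /andP[] := bnd b (conj b0 b1).
by move=> ? ? ? ?; apply/andP; split; lra.
Qed.

Lemma alloc_itv t a b : inW a -> inW b -> 0 <= alloc t a b <= 1.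
Proof. by move=> aW bW; apply/g01/signal_itv. Qed.

(** Normalized prices are at most [1], so the signal is 1-Lipschitz for [wdist] and only the slope
    of [g] remains. *)
Lemma alloc_lip t a b a' b' :
  `|alloc t a b - alloc t a' b'| <= t.+1%:R / 2 * (wdist a a' + wdist b b').
Proof.
apply: le_trans (g_lip _ _ _) _; rewrite ler_wpM2l //.
rewrite -sumrB -big_split /=; apply: le_trans (ler_norm_sum _ _ _) _.
apply: ler_sum => i _; rewrite -mulrBl normrM.
have /andP[v0 v1] := (proj2 mok) t i.
apply: (@le_trans _ _ `|a i - b i - (a' i - b' i)|).
  by apply: ler_piMr => //; rewrite gtr0_norm.
have -> : a i - b i - (a' i - b' i) = (a i - a' i) - (b i - b' i) by ring.
exact: ler_normB.
Qed.

Lemma regW_alloc t : regW (alloc t).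
Proof.
exists (1 + t.+1%:R / 2); split.
- by rewrite addr_ge0.
- move=> a b aW bW; have /andP[A0 A1] := alloc_itv t aW bW; rewrite ger0_norm //.
  have : 0 <= t.+1%:R / 2 :> R by [].
  lra.
- move=> a b a' b' _ _ _ _; apply: le_trans (alloc_lip _ _ _ _ _) _.
  by rewrite ler_wpM2r ?addr_ge0 ?wdist_ge0 // lerDr.
Qed.

Lemma xret1_gt0 t : 0 < (xret alpha y t).1.
Proof. by have [/(_ t) /andP[]] := mok. Qed.

Lemma xret2_gt0 t : 0 < (xret alpha y t).2.
Proof.
have [/(_ t) /andP[_ y1] _] := mok.
(* With [1] written as [alpha / alpha] the numerator is [alpha + 1 - y t], positive by the upper
   bound on the price factor. *)
rewrite /= -[X in X + _](@divff _ alpha) ?gt_eqF // -mulrDl divr_gt0 //; lra.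
Qed.

Let S := MA g v.

(** The two weights are nonnegative and cannot both vanish, while both asset returns are
    positive. *)
Lemma Ret_gt0 n a b : inW a -> inW b -> 0 < Ret alpha S y n a b.
Proof.
move=> aW bW; apply: prodr_gt0 => t _.
have /andP[A0 A1] := alloc_itv t aW bW.
have x1 := xret1_gt0 t; have x2 := xret2_gt0 t.
rewrite /dot2 /S /MA -/(signal t a b) -/(alloc t a b) [X in X * _]/= [X in _ + X * _]/=.
have [A_lt1|] := ltP (alloc t a b) 1.
  by rewrite ltr_wpDl ?mulr_ge0 ?mulr_gt0 ?subr_gt0 // ltW.
move=> A_ge1; have A_gt0 := lt_le_trans ltr01 A_ge1.
by apply: ltr_pwDl; [exact: mulr_gt0|rewrite mulr_ge0 ?subr_ge0 // ltW].
Qed.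

Variable eps : R.
Hypothesis eps01 : 0 < eps < 1.
Let E := emod eps S.
(** The mass moved to the uniform portfolio on day [t]; each asset is thereby guaranteed
    [mix t / 2]. *)
Let mix t : R := eps / (2 * t.+1%:R ^+ 2).

Lemma half_mix t : eps / (4 * t.+1%:R ^+ 2) = mix t / 2.
Proof.
rewrite /mix; have : t.+1%:R != 0 :> R by rewrite pnatr_eq0.
by move: (t.+1%:R) => u u0; field.
Qed.

Lemma mix_gt0 t : 0 < mix t.
Proof. by have /andP[e0 _] := eps01; rewrite divr_gt0 // mulr_gt0 // exprn_gt0. Qed.

(** Amounts to [mix t <= 1 / (t + 2)], which follows from [eps < 1] and [t + 2 <= 2 * (t + 1) ^ 2].
    The ratio form is chosen because its product over days telescopes. *)
Lemma ratio_le_mix t : t.+1%:R / t.+2%:R <= 1 - mix t.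
Proof.
have /andP[e0 e1] := eps01; rewrite /mix -[t.+2%:R]natr1.
have : 1 <= t.+1%:R :> R by rewrite ler1n.
move: (t.+1%:R) => u u1.
rewrite ler_pdivrMr; last by lra.
rewrite -subr_ge0.
have -> : (1 - eps / (2 * u ^+ 2)) * (u + 1) - u = (2 * u ^+ 2 - eps * (u + 1)) / (2 * u ^+ 2).
  by field; lra.
by rewrite divr_ge0 //; nra.
Qed.

Lemma emod_long t a b : (E t a b).1 = (1 - mix t) * alloc t a b + mix t / 2.
Proof. by rewrite /E /emod [LHS]/= half_mix. Qed.

Lemma emod_short t a b : (E t a b).2 = (1 - mix t) * (1 - alloc t a b) + mix t / 2.
Proof. by rewrite /E /emod [LHS]/= half_mix. Qed.

Lemma regW_E1 t : regW (fun a b => (E t a b).1).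
Proof.
under eq_fun do under eq_fun do rewrite emod_long.
by apply: regWD; [apply: regWM; [|exact: regW_alloc]|]; exact: regW_cst.
Qed.

Lemma regW_E2 t : regW (fun a b => (E t a b).2).
Proof.
(* Negation becomes a product with the constant [-1], so that closure under sums and products
   suffices. *)
under eq_fun do under eq_fun do rewrite emod_short -[- alloc t _ _]mulN1r.
apply: regWD; last exact: regW_cst.
apply: regWM; first exact: regW_cst.
apply: regWD; first exact: regW_cst.
by apply: regWM; [exact: regW_cst|exact: regW_alloc].
Qed.

Lemma regW_Ret n : regW (Ret alpha E y n).
Proof.
elim: n => [|n IH].
  rewrite (_ : Ret _ _ _ _ = fun _ _ => 1); first exact: regW_cst.
  by apply/funext => a; apply/funext => b; rewrite /Ret big_ord0.
rewrite (_ : Ret _ _ _ _ = fun a b => Ret alpha E y n a b * dot2 (E n a b) (xret alpha y n)).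
  apply: regWM => //; apply: regWD; apply: regWM;
  [exact: regW_E1|exact: regW_cst|exact: regW_E2|exact: regW_cst].
by apply/funext => a; apply/funext => b; rewrite /Ret big_ord_recr.
Qed.

Lemma emod_ge t a b : inW a -> inW b ->
  t.+1%:R / t.+2%:R * dot2 (S t a b) (xret alpha y t) <= dot2 (E t a b) (xret alpha y t).
Proof.
move=> aW bW; have /andP[A0 A1] := alloc_itv t aW bW.
have x1 := xret1_gt0 t; have x2 := xret2_gt0 t.
have cr := ratio_le_mix t; have c0 := mix_gt0 t.
rewrite /dot2 emod_long emod_short /S /MA -/(signal t a b) -/(alloc t a b).
rewrite [(alloc t a b, _).1]/= [(alloc t a b, _).2]/=.
rewrite mulrDr !mulrA; apply: lerD; rewrite ler_pM2r //.
- apply: (@le_trans _ _ ((1 - mix t) * alloc t a b)); last by lra.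
  by rewrite ler_wpM2r.
- apply: (@le_trans _ _ ((1 - mix t) * (1 - alloc t a b))); last by lra.
  by rewrite ler_wpM2r // subr_ge0.
Qed.

(** The guaranteed mass [mix t / 2] in each asset turns an absolute error in the allocation into a
    relative error [rho] in the return, whatever the market does. *)
Lemma emod_near t (rho : R) a b a' b' : inW a -> inW b -> inW a' -> inW b' ->
  0 <= rho <= 1 -> `|alloc t a b - alloc t a' b'| <= mix t / 2 * rho ->
  (1 - rho) * dot2 (E t a' b') (xret alpha y t) <= dot2 (E t a b) (xret alpha y t).
Proof.
move=> aW bW a'W b'W /andP[rho0 rho1].
have /andP[A0 A1] := alloc_itv t aW bW; have /andP[A0' A1'] := alloc_itv t a'W b'W.
have x1 := xret1_gt0 t; have x2 := xret2_gt0 t.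
have c0 := mix_gt0 t.
have c1 : 0 <= 1 - mix t by apply: le_trans (ratio_le_mix t).
rewrite /dot2 !emod_long !emod_short ler_norml => /andP[].
move: (alloc t a b) (alloc t a' b') (mix t) A0 A1 A0' A1' c0 c1 => u u' d u0 u1 u'0 u'1 d0 d1 lo hi.
have drho : 0 <= d / 2 * rho by rewrite mulr_ge0 // divr_ge0 // ltW.
(* One claim serves both assets: for the short position [z] and [z'] are [1 - u] and [1 - u']. *)
have key (z z' : R) : 0 <= z' -> z' - z <= d / 2 * rho ->
    (1 - rho) * ((1 - d) * z' + d / 2) <= (1 - d) * z + d / 2.
  move=> z'0 zz'.
  have h1 : (1 - d) * (z' - z) <= d / 2 * rho.
    apply: (@le_trans _ _ ((1 - d) * (d / 2 * rho))); first by rewrite ler_wpM2l.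
    by rewrite ler_piMl //; lra.
  have h2 : 0 <= rho * ((1 - d) * z') by rewrite !mulr_ge0.
  lra.
rewrite mulrDr !mulrA; apply: lerD; rewrite ler_pM2r //; apply: key; lra.
Qed.

Variable n : nat.
Let delta : R := eps / (8 * k%:R * n.+1%:R ^+ 4).

Lemma delta_itv : 0 <= delta <= 1.
Proof.
have /andP[e0 e1] := eps01.
have D1 : 1 <= 8 * k%:R * n.+1%:R ^+ 4 :> R.
  rewrite -[X in X <= _]mulr1 ler_pM //; last by rewrite exprn_ege1 // ler1n.
  have : 1 <= k%:R :> R by rewrite ler1n.
  lra.
have D0 := lt_le_trans ltr01 D1.
rewrite /delta divr_ge0 ?(ltW e0) ?(ltW D0) //= ler_pdivrMr // mul1r.
exact: le_trans (ltW e1) D1.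
Qed.

(** The factor [8 * k] in [delta] absorbs the constants; what remains is
    [(t + 1) ^ 3 * (t + 2) <= (n + 1) ^ 4], whence the fourth power. *)
Lemma delta_small t : (t < n)%N ->
  t.+1%:R / 2 * (2 * k%:R * delta + 2 * k%:R * delta) <= mix t / 2 * t.+2%:R^-1.
Proof.
move=> tn; have /andP[e0 e1] := eps01; rewrite /delta /mix.
have t0 : 0 < t.+1%:R :> R by [].
have t20 : 0 < t.+2%:R :> R by [].
have n0 : 0 < n.+1%:R :> R by [].
have k0 : 0 < k%:R :> R by [].
have tn1 : t.+1%:R <= n.+1%:R :> R by rewrite ler_nat ltnS ltnW.
have tn2 : t.+2%:R <= n.+1%:R :> R by rewrite ler_nat ltnS.
move: (t.+1%:R) (t.+2%:R) (n.+1%:R) (k%:R) t0 t20 n0 k0 tn1 tn2 => u u' m K u0 u'0 m0 K0 um u'm.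
rewrite [leLHS](_ : _ = eps / 4 * (u / m ^+ 4)); last by field; lra.
rewrite [leRHS](_ : _ = eps / 4 * (u ^+ 2 * u')^-1); last by field; lra.
rewrite ler_pM2l ?divr_gt0 // ler_pdivrMr ?exprn_gt0 // mulrC ler_pdivlMr ?mulr_gt0 ?exprn_gt0 //.
rewrite (_ : u * _ = u * u * u * u'); last by ring.
rewrite (_ : m ^+ 4 = m * m * m * m); last by ring.
by rewrite !ler_pM ?mulr_ge0 // ltW.
Qed.

Lemma Ret_emod_near wF wS a b : inW wF -> inW wS -> inW a -> inW b ->
  wdist a wF <= 2 * k%:R * delta -> wdist b wS <= 2 * k%:R * delta ->
  n.+1%:R^-1 ^+ 2 * Ret alpha S y n wF wS <= Ret alpha E y n a b.
Proof.
move=> FW SW aW bW aF bS.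
(* Each factor [1 / (n + 1)] is unfolded into daily ratios: one copy pays for the modification, the
   other for moving within the box. The products are then compared day by day. *)
rewrite expr2 -prod_succ_ratio -!big_split /=; apply: ler_prod => t _.
have r0 : 0 <= t.+1%:R / t.+2%:R :> R by rewrite divr_ge0.
apply/andP; split.
  rewrite !mulr_ge0 //.
  (* Positivity of a single day's factor is read off from two consecutive positive returns. *)
  have := Ret_gt0 t.+1 FW SW; rewrite /Ret big_ord_recr /= pmulr_rgt0; first exact: ltW.
  exact: Ret_gt0.
rewrite -mulrA; apply: (@le_trans _ _ (t.+1%:R / t.+2%:R * dot2 (E t wF wS) (xret alpha y t))).
  by rewrite ler_wpM2l // emod_ge.
(* This identifies the relative error as [rho = 1 / (t + 2)]. *)
have -> : t.+1%:R / t.+2%:R = 1 - t.+2%:R^-1 :> R.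
  have : 0 < t.+1%:R :> R by [].
  by rewrite -[t.+2%:R]natr1; move: (t.+1%:R) => u u0; field; lra.
apply: emod_near => //.
  by rewrite invr_ge0 /= ler0n invf_le1 // ler1n.
apply: le_trans (alloc_lip _ _ _ _ _) _; apply: le_trans (delta_small (ltn_ord t)).
by rewrite ler_wpM2l // lerD.
Qed.

Lemma Ret_emod_ge0 a b : inW a -> inW b -> 0 <= Ret alpha E y n a b.
Proof.
move=> aW bW; apply: prodr_ge0 => t _; apply: le_trans (emod_ge _ aW bW).
rewrite mulr_ge0 ?divr_ge0 //.
have := Ret_gt0 t.+1 aW bW; rewrite /Ret big_ord_recr /= pmulr_rgt0; first exact: ltW.
exact: Ret_gt0.
Qed.

Lemma muint_Ret_ge wF wS : inW wF -> inW wS ->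
  n.+1%:R^-1 ^+ 2 * (delta / k%:R) ^+ k' * (delta / k%:R) ^+ k' * Ret alpha S y n wF wS
    <= muint (Ret alpha E y n).
Proof.
move=> FW SW.
have I := intW_box (regW_Ret n) FW SW delta_itv Ret_emod_ge0
  (fun a b aW bW => Ret_emod_near FW SW aW bW).
have d0 : 0 <= delta / k%:R by rewrite divr_ge0 //; case/andP: delta_itv.
have Z0 := intW1_gt0 FW SW; have Z1 := intW1_le1 R k'.
have I0 : 0 <= intW (Ret alpha E y n).
  by apply: le_trans I; rewrite !mulr_ge0 ?exprn_ge0 //; exact/ltW/Ret_gt0.
rewrite /muint; apply: (@le_trans _ _ (intW (Ret alpha E y n))).
  by apply: le_trans I; rewrite mulrAC (mulrAC (_ ^+ 2)).
by rewrite ler_pdivlMr // ler_piMr.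
Qed.

Lemma muint_Ret_gt0 wF wS : inW wF -> inW wS -> 0 < muint (Ret alpha E y n).
Proof.
move=> FW SW; apply: lt_le_trans (muint_Ret_ge FW SW).
have /andP[e0 e1] := eps01.
have d0 : 0 < delta / k%:R by rewrite /delta !divr_gt0 // !mulr_gt0 // exprn_gt0.
by rewrite !mulr_gt0 ?exprn_gt0 ?Ret_gt0.
Qed.

End Allocation.

(** * Telescoping and the growth rate *)

Lemma muint_lin (R : realType) (k' : nat) (F G : ('I_k'.+1 -> R) -> ('I_k'.+1 -> R) -> R)
  (x y : R) : regW F -> regW G ->
  muint (fun a b => x * F a b + y * G a b) = x * muint F + y * muint G.
Proof. by move=> rF rG; rewrite /muint intW_lin // mulrDl -!mulrA. Qed.

(* The day-t factor is a ratio of consecutive averaged returns, so the product telescopes. *)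
Lemma RetU_univ (R : realType) (k' : nat) (alpha : R) (E : strategy R k'.+1) y n :
  (forall t, regW (fun a b => (E t a b).1)) ->
  (forall t, regW (fun a b => (E t a b).2)) ->
  (forall t, regW (Ret alpha E y t)) ->
  (forall t, 0 < muint (Ret alpha E y t)) ->
  0 < @intW R k'.+1 (fun _ _ => 1) ->
  RetU alpha (univ alpha E y) y n = muint (Ret alpha E y n).
Proof.
move=> r1 r2 rR M0 Z0; elim: n => [|n IH].
  rewrite /RetU big_ord0 /muint (_ : Ret _ _ _ _ = fun _ _ => 1).
    by rewrite divff // gt_eqF.
  by apply/funext => a; apply/funext => b; rewrite /Ret big_ord0.
rewrite /RetU big_ord_recr /= -/(RetU _ _ _ _) IH.
have -> : Ret alpha E y n.+1 = fun a b =>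
    (xret alpha y n).1 * ((E n a b).1 * Ret alpha E y n a b) +
    (xret alpha y n).2 * ((E n a b).2 * Ret alpha E y n a b).
  apply/funext => a; apply/funext => b.
  by rewrite /Ret big_ord_recr /dot2 /= -/(Ret alpha E y n a b); ring.
rewrite /dot2 /univ [(_, _).1]/= [(_, _).2]/=.
rewrite muint_lin; [|exact: regWM..].
have := M0 n; move: (muint (Ret _ _ _ _)) => M M_gt0.
by field; rewrite gt_eqF.
Qed.

(** Applies the sublinearity of [ln] to the square root. It allows an explicit loss of order
    [n ^ (-1/2)], whose convergence to [0] is immediate. *)
Lemma ln_le_sqrt (R : realType) (x : R) : 0 < x -> ln x <= 2 * Num.sqrt x.
Proof.
move=> x0; rewrite -[X in ln X]sqr_sqrtr; last exact: ltW.
have s0 : 0 < Num.sqrt x by rewrite sqrtr_gt0.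
by rewrite lnXn // mulr_natl lerMn2r /= ltW // ln_sublinear.
Qed.

Lemma universalizable_MA (R : realType) (k' : nat) (alpha : R) (g : nat -> R -> R) :
  0 < alpha ->
  (forall t x, -1 <= x <= 1 -> 0 <= g t x <= 1) ->
  (forall t x y, `|g t x - g t y| <= t.+1%:R / 2 * `|x - y|) ->
  @universalizable R k'.+1 alpha (@MA R k'.+1 g).
Proof.
move=> alpha0 g01 glip eps eps01; have /andP[e0 e1] := eps01.
(* The side [delta / k] of the box equals [q / (n + 1) ^ 4], which separates the dependence on
   [n]. *)
pose q : R := eps / (8 * k'.+1%:R ^+ 2).
pose L : R := - ln q.
have q0 : 0 < q by rewrite divr_gt0 // mulr_gt0 // exprn_gt0.
have L0 : 0 <= L.
  rewrite oppr_ge0 ln_le0 // ler_pdivrMr ?mulr_gt0 ?exprn_gt0 // mul1r.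
  apply: (le_trans (ltW e1)); rewrite -[X in X <= _]mul1r ler_pM // ?ler1n //.
  by rewrite exprn_ege1 // ler1n.
(* The logarithmic loss is at most [2 * k' * L + (8 * k' + 2) * ln (n + 1)]: two boxes of dimension
   [k'] with sides of order [n ^ -4], plus the squared daily loss. Then
   [ln (n + 1) <= 2 * sqrt (n + 1)] and [n + 1 <= 2 * n] give the constants of [K]. *)
pose K : R := 4 * k'%:R * L + 4 * (8 * k'%:R + 2).
exists (fun n => K * Num.sqrt (harmonic n)); split.
  rewrite -[X in _ --> X](mulr0 K); apply: cvgMr.
  rewrite -[X in _ --> X](@sqrtr0 R).
  by apply: (cvg_comp _ _ (@cvg_harmonic R)); exact: sqrt_continuous.
move=> n n0 y v mok wF wS FW SW.
have M0 t := muint_Ret_gt0 alpha0 g01 glip mok eps01 t FW SW.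
have U := RetU_univ n (regW_E1 g01 glip mok eps) (regW_E2 g01 glip mok eps)
  (regW_Ret g01 glip mok eps) M0 (intW1_gt0 FW SW).
have := muint_Ret_ge alpha0 g01 glip mok eps01 n FW SW.
have := M0 n; rewrite -{}U /LretU /Lret.
have := Ret_gt0 alpha0 g01 mok n FW SW.
move: (Ret _ _ _ _ _ _) (RetU _ _ _ _) => r u r0 u0.
have N0 : 0 < n.+1%:R :> R by [].
have -> : eps / (8 * k'.+1%:R * n.+1%:R ^+ 4) / k'.+1%:R = q / n.+1%:R ^+ 4.
  rewrite /q; have : 0 < k'.+1%:R :> R by [].
  by move: (n.+1%:R) (k'.+1%:R) N0 => N k N0 k0; field; lra.
have d0 : 0 < q / n.+1%:R ^+ 4 by rewrite divr_gt0 // exprn_gt0.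
have lnd : ln (q / n.+1%:R ^+ 4) = - L - 4 * ln n.+1%:R.
  by rewrite ln_div ?posrE ?exprn_gt0 // lnXn // /L opprK mulr_natl.
move: (q / _) d0 lnd => d d0 lnd ru.
have : ln (n.+1%:R^-1 ^+ 2 * d ^+ k' * d ^+ k' * r) <= ln u.
  by rewrite ler_ln // posrE !mulr_gt0 // exprn_gt0.
have dk0 : 0 < d ^+ k' by rewrite exprn_gt0.
have p0 : 0 < n.+1%:R^-1 ^+ 2 :> R by rewrite exprn_gt0 // invr_gt0.
rewrite !lnM ?posrE ?mulr_gt0 // !lnXn ?invr_gt0 // lnV ?posrE // lnd.
rewrite -[_ *+ k']mulr_natl.
set l := ln n.+1%:R => lnu.
have ls : l <= 2 * Num.sqrt n.+1%:R by exact: ln_le_sqrt.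
have -> : Num.sqrt (harmonic n) = (Num.sqrt n.+1%:R)^-1 :> R.
  by rewrite /harmonic sqrtrV.
have s2 : Num.sqrt n.+1%:R * Num.sqrt n.+1%:R = n%:R + 1 :> R.
  by rewrite -expr2 sqr_sqrtr // natr1.
have s1 : 1 <= Num.sqrt n.+1%:R :> R.
  by rewrite -[X in X <= _]sqrtr1 ler_wsqrtr // ler1n.
have n1 : 1 <= n%:R :> R by rewrite ler1n.
have k0 : 0 <= k'%:R :> R by [].
rewrite /K; move: (Num.sqrt _) l (ln r) (ln u) (n%:R) (k'%:R) ls s2 s1 n1 k0 lnu.
move=> s {}l r' u' N k ls s2 s1 N1 k0 lnu.
have N0' : 0 < N by lra.
have s0 : 0 < s by lra.
have kL0 : 0 <= k * L by rewrite mulr_ge0.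
have ss : s <= s * s by rewrite ler_peMr // ltW.
pose B := 2 * (k * L) + (8 * k + 2) * (2 * s).
have rB : r' - u' <= B.
  have : (8 * k + 2) * l <= (8 * k + 2) * (2 * s) by rewrite ler_wpM2l //; lra.
  rewrite /B; lra.
have BK : B * s <= (4 * k * L + 4 * (8 * k + 2)) * N.
  have kLs : k * L * s <= k * L * (N + 1) by rewrite ler_wpM2l // -s2.
  have kN : k * L * 1 <= k * L * N by rewrite ler_wpM2l.
  have kk : k * 1 <= k * N by rewrite ler_wpM2l.
  have -> : B * s = 2 * (k * L * s) + (8 * k + 2) * (2 * (s * s)) by rewrite /B; ring.
  rewrite s2; lra.
rewrite lerBlDr -lerBlDl -mulrBl; apply: (@le_trans _ _ (B / N)).
  by rewrite ler_pM2r // invr_gt0.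
by rewrite ler_pdivrMr // mulrAC ler_pdivlMr.
Qed.

(** * The two allocation functions *)

Lemma g_line_itv (R : realType) (x : R) : -1 <= x <= 1 -> 0 <= g_line x <= 1.
Proof. by rewrite /g_line => /andP[? ?]; apply/andP; split; lra. Qed.

Lemma g_line_lip (R : realType) t (x y : R) :
  `|g_line x - g_line y| <= t.+1%:R / 2 * `|x - y|.
Proof.
have -> : g_line x - g_line y = 1 / 2 * (x - y) by rewrite /g_line; field.
by rewrite normrM ger0_norm // ler_wpM2r // ler_pM2r // ler1n.
Qed.

(** The step approximation at [t = 1]; the others are its rescalings, so one Lipschitz estimate
    serves all days. *)
Definition ramp (R : realType) (x : R) : R :=
  if x < -1 then 0 else if x <= 1 then (x + 1) / 2 else 1.

Lemma g_stepE (R : realType) t (x : R) : (0 < t)%N -> g_step t x = ramp (t%:R * x).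
Proof.
rewrite -(ltr0n R) /g_step /ramp => t0.
rewrite -(ltr_pM2l t0) -(ler_pM2l t0 x) mulrN divff ?gt_eqF //.
by do 2 case: ifP => // _; field; rewrite gt_eqF.
Qed.

Lemma ramp_itv (R : realType) (x : R) : 0 <= ramp x <= 1.
Proof.
rewrite /ramp; case: (ltP x (-1)) => ?; [|case: (leP x 1) => ?];
  apply/andP; split; lra.
Qed.

Lemma ramp_lip (R : realType) (x y : R) : `|ramp x - ramp y| <= `|x - y| / 2.
Proof.
wlog xy : x y / y <= x.
  by move=> W; have [|/ltW] := leP y x; [|rewrite distrC (distrC x)]; exact: W.
rewrite (ger0_norm (x := x - y)) ?subr_ge0 // ler_norml /ramp.
by case: (ltP x (-1)) => ?; case: (ltP y (-1)) => ?; case: (leP x 1) => ?;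
  case: (leP y 1) => ?; apply/andP; split; lra.
Qed.

(** The slope on day [t] is [maxn t 1 / 2], and [maxn t 1 <= t + 1] holds on day 0 as well. *)
Lemma g_day_lip (R : realType) t (x y : R) :
  `|g_day t x - g_day t y| <= t.+1%:R / 2 * `|x - y|.
Proof.
have t0 : (0 < maxn t 1)%N by rewrite leq_max orbT.
rewrite /g_day !g_stepE //; apply: le_trans (ramp_lip _ _) _.
rewrite -mulrBr normrM normr_nat mulrAC ler_wpM2r // ler_pM2r // ler_nat.
by rewrite geq_max leqnSn.
Qed.

Theorem mainTheorem6 (R : realType) (k : nat) (alpha : R) :
  (2 <= k)%N -> 0 < alpha <= 1 ->
  @universalizable R k alpha (@MA R k (fun _ => @g_line R)) /\
  @universalizable R k alpha (@MA R k (@g_day R)).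
Proof.
case: k => // k _ /andP[alpha0 _]; split; apply: universalizable_MA => //.
- by move=> _ x; exact: g_line_itv.
- by move=> t x y; exact: g_line_lip.
- by move=> t x _; rewrite /g_day g_stepE ?leq_max ?orbT // ramp_itv.
- exact: g_day_lip.
Qed.
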